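(* Let $m\ge 1$ and let $\alpha_1,\dots,\alpha_m\ge 1$ be integers. Let $X\sim\mathrm{Exp}(1)$. The number of directed Hamiltonian paths in the complete multipartite graph $K_{\alpha_1,\alpha_2,\dots,\alpha_m}$ equals $$\mathbb E\left[\prod_{i=1}^m(-1)^{\alpha_i}\alpha_i!\,L^{(-1)}_{\alpha_i}(X)\right].$$
   Context: $K_{\alpha_1,\dots,\alpha_m}$ is the complete $m$-partite graph with parts of sizes $\alpha_1,\dots,\alpha_m$ (for $m=1$ it is the edgeless graph). A directed Hamiltonian path is a directed path visiting every vertex exactly once; a path with at least two vertices and its reversal are counted as different, and in a one-vertex graph the single vertex counts as one such path. $\mathrm{Exp}(1)$ is the exponential distribution with density $e^{-x}$ on $[0,\infty)$. The associated Laguerre polynomials are $L_n^{(-1)}(t)=\frac{(-1)^n}{n!}e^{-tD^2}[t^n]$, where $D=\frac{d}{dt}$ and $e^{-tD^2}=\sum_{k\ge0}\frac{(-1)^k}{k!}(tD^2)^k$ with $tD^2$ the operator $p(t)\mapsto t\,p''(t)$; explicitly, for $n\ge 1$, $(-1)^n n!\,L_n^{(-1)}(t)=\sum_{k=1}^n(-1)^{n-k}\frac{n!}{k!}\binom{n-1}{k-1}t^k$. *)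

(* Defs.v *)
From HB Require Import structures.
From mathcomp Require Import all_boot all_order all_algebra.
From mathcomp Require Import all_classical all_reals all_analysis.

Set Implicit Arguments.
Unset Strict Implicit.
Unset Printing Implicit Defensive.

Import Order.TTheory GRing.Theory Num.Theory.

Local Open Scope ring_scope.

(* A directed path is the sequence of its vertices, so a path and its reversal
   are the same only when there is a single vertex. *)
Definition hamiltonian_path (T : finType) (e : rel T) (p : seq T) : bool :=
  sorted e p && [forall v, count_mem v p == 1%N].

Lemma hamiltonian_path_size (T : finType) (e : rel T) (p : seq T) :
  hamiltonian_path e p -> size p = #|T|.
Proof.
case/andP=> _ /forallP p1.
have /perm_size -> : perm_eq p (enum T); last by rewrite cardE.
apply/allP => v _ /=.
by rewrite (eqP (p1 v)) count_uniq_mem ?enum_uniq// mem_enum.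
Qed.

(* By hamiltonian_path_size no Hamiltonian path is missed by the restriction
   to sequences of length #|T|. *)
Definition num_hamiltonian_paths (T : finType) (e : rel T) : nat :=
  #|[set p : #|T|.-tuple T | hamiltonian_path e p]|.

(* The vertex (i, j) is the j-th vertex of the i-th part. *)
Definition multipartite_vertex (m : nat) (alpha : 'I_m -> nat) : finType :=
  {i : 'I_m & 'I_(alpha i)}.

Definition complete_multipartite (m : nat) (alpha : 'I_m -> nat) :
    rel (multipartite_vertex alpha) :=
  fun u v => tag u != tag v.

Definition tD2 (F : fieldType) (p : {poly F}) : {poly F} := 'X * p^`(2).

(* tD2 lowers the degree, so the exponential series is the finite sum
   over k < size p; see exp_NtD2_widen. *)
Definition exp_NtD2 (F : fieldType) (p : {poly F}) : {poly F} :=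
  \sum_(k < size p) ((-1) ^+ k / k`!%:R) *: iter k (@tD2 F) p.

Lemma size_tD2 (F : fieldType) (p : {poly F}) :
  (size (tD2 p) <= (size p).-1)%N.
Proof.
have szD (q : {poly F}) : (size q^`() <= (size q).-1)%N.
  have [->|q0] := eqVneq q 0; first by rewrite deriv0 size_poly0.
  by rewrite -ltnS prednK ?size_poly_gt0// lt_size_deriv.
rewrite /tD2 derivnS derivn1.
have [->|q0] := eqVneq (p^`()^`()) 0; first by rewrite mulr0 size_poly0.
rewrite mulrC size_mulX//.
have q1 : p^`() != 0 by apply: contraNneq q0 => ->; rewrite deriv0.
apply: leq_trans (szD p).
by apply: lt_size_deriv.
Qed.

Lemma iter_tD2_eq0 (F : fieldType) (p : {poly F}) (k : nat) :
  (size p <= k)%N -> iter k (@tD2 F) p = 0.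
Proof.
move=> pk; apply/eqP; rewrite -size_poly_leq0.
suff H : (size (iter k (@tD2 F) p) <= size p - k)%N.
  by apply: leq_trans H _; rewrite leqn0 subn_eq0.
elim: k {pk} => [|k IH]; first by rewrite subn0.
apply: (leq_trans (size_tD2 _)).
by rewrite subnS -!subn1 leq_sub2r.
Qed.

Lemma exp_NtD2_widen (F : fieldType) (p : {poly F}) (N : nat) :
  (size p <= N)%N ->
  exp_NtD2 p = \sum_(k < N) ((-1) ^+ k / k`!%:R) *: iter k (@tD2 F) p.
Proof.
move=> pN.
rewrite /exp_NtD2 (big_ord_widen N
  (fun k : nat => ((-1) ^+ k / k`!%:R) *: iter k (@tD2 F) p))// big_mkcond/=.
apply: eq_bigr => k _; case: ltnP => // pk.
by rewrite iter_tD2_eq0// scaler0.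
Qed.

(* L_n^(-1) *)
Definition laguerreN1 (F : fieldType) (n : nat) : {poly F} :=
  ((-1) ^+ n / n`!%:R) *: exp_NtD2 'X^n.

(* Main.v *)
(** Write q_n for e^{-tD^2}[t^n] = (-1)^n n! L_n^{(-1)}(t) and E for the linear
    functional t^n |-> n! on polynomials, which is the expectation under Exp(1).
    Two rules match the ways a path can be built from its first vertex:
    E p = p(0) + E p' (integration by parts) and q_{n+1}' = (n+1) (q_n - q_n').
    By induction on the number of vertices, E (\prod_i q_{a_i}) counts the
    arrangements of a colored vertex set, with a_i vertices of color i, in which
    neighbors have different colors, and E (q_{a_i}' \prod_{j != i} q_{a_j})
    counts those that begin with color i. The Leibniz rule in E p = p(0) + E p'
    splits the arrangements by the color of the first vertex; removing that
    vertex, one of the a_i of color i, leaves an arrangement that does not begin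
    with color i, whence the factor a_i (q_{a_i - 1} - q_{a_i - 1}'). *)

Require Import Defs.
From HB Require Import structures.
From mathcomp Require Import all_boot all_order all_algebra.
From mathcomp Require Import all_classical all_reals all_analysis.
From mathcomp Require Import measurable_realfun.
From mathcomp Require Import ring zify.

Set Implicit Arguments.
Unset Strict Implicit.
Unset Printing Implicit Defensive.

Import Order.TTheory GRing.Theory Num.Theory.

Local Open Scope ring_scope.

(** * The product rule for finite products of polynomials *)

Lemma deriv1 (R : nzRingType) : (1 : {poly R})^`() = 0.
Proof. by rewrite -polyC1 derivC. Qed.

Lemma deriv_prod (R : comNzRingType) (I : finType) (f : I -> {poly R}) :
  (\prod_i f i)^`() = \sum_i (f i)^`() * \prod_(j | j != i) f j.
Proof.
(* Distinct entries make [j != i] drop exactly one factor. *)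
suff H (r : seq I) : uniq r ->
    (\prod_(i <- r) f i)^`() =
    \sum_(i <- r) (f i)^`() * \prod_(j <- r | j != i) f j.
  by rewrite H ?index_enum_uniq.
elim: r => [|k r IH] /=; first by rewrite !big_nil deriv1.
case/andP=> kr ur; rewrite !big_cons derivM eqxx IH//; congr (_ * _ + _).
  rewrite big_seq [RHS]big_seq_cond; apply: eq_bigl => j.
  by case: (boolP (j \in r)) => //= jr; apply/esym; apply: contraNneq kr => <-.
rewrite mulr_sumr big_seq [RHS]big_seq; apply: eq_bigr => i ir.
rewrite big_cons ifT; first by rewrite mulrCA.
by apply: contraNneq kr => ->.
Qed.

(** * The functional E on polynomials *)

Definition fact_moment (F : nzRingType) (p : {poly F}) : F :=
  \sum_(i < size p) p`_i * i`!%:R.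

Lemma fact_moment_widen (F : nzRingType) (p : {poly F}) (N : nat) :
  (size p <= N)%N -> fact_moment p = \sum_(i < N) p`_i * i`!%:R.
Proof.
move=> pN; rewrite /fact_moment (big_ord_widen N
  (fun i => p`_i * i`!%:R))// big_mkcond/=.
by apply: eq_bigr => i _; case: ltnP => // pi; rewrite nth_default ?mul0r.
Qed.

Lemma fact_moment_is_zmod_morphism (F : nzRingType) :
  zmod_morphism (@fact_moment F).
Proof.
move=> p q; pose N := maxn (size p) (size q).
have pN : (size p <= N)%N by rewrite leq_maxl.
have qN : (size q <= N)%N by rewrite leq_maxr.
rewrite (fact_moment_widen pN) (fact_moment_widen qN).
rewrite (@fact_moment_widen _ _ N); last first.
  by rewrite (leq_trans (size_polyD _ _))// size_polyN.
by rewrite -sumrB; apply: eq_bigr => i _; rewrite coefB mulrBl.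
Qed.

HB.instance Definition _ (F : nzRingType) :=
  GRing.isZmodMorphism.Build {poly F} F (@fact_moment F)
    (@fact_moment_is_zmod_morphism F).

Lemma fact_moment1 (F : nzRingType) : fact_moment (1 : {poly F}) = 1.
Proof. by rewrite /fact_moment size_poly1 big_ord1 coef1 mulr1. Qed.

(* Integration by parts for [fun t => p.[t] * expR (- t)] on [0, +oo[. *)
Lemma fact_moment_deriv (F : comNzRingType) (p : {poly F}) :
  fact_moment p = p`_0 + fact_moment p^`().
Proof.
rewrite (@fact_moment_widen _ p (size p).+1)// big_ord_recl fact0 mulr1.
congr (_ + _); rewrite (@fact_moment_widen _ _ (size p)); last first.
  have [->|p0] := eqVneq p 0; first by rewrite deriv0.
  exact/ltnW/lt_size_deriv.
apply: eq_bigr => i _.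
by rewrite coef_deriv lift0 factS natrM mulrA (mulr_natr p`_i.+1).
Qed.

(** * The polynomials q_n: expansion and derivative rule *)

Lemma iter_tD2_Xn (F : fieldType) (n k : nat) :
  iter k (@tD2 F) 'X^n = (n ^_ k * n.-1 ^_ k)%:R *: 'X^(n - k).
Proof.
elim: k => [|k IH]; first by rewrite subn0 muln1 scale1r.
rewrite iterS IH /tD2 derivnZ derivnXn -scalerAr mulrnAr -exprS.
rewrite -scaler_nat scalerA -natrM !ffactnSr ffactn0 mul1n subn0.
have E : (n - k - 1 = n.-1 - k)%N by lia.
(* If [n.-1 - k] is 0, both coefficients vanish and the truncated exponents do not matter. *)
rewrite E; have [->|{}E] := posnP (n.-1 - k); first by rewrite !muln0 !scale0r.
have -> : (n - k - 2).+1 = (n - k.+1)%N by lia.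
by congr (_%:R *: _); rewrite mulnACA.
Qed.

Section exp_NtD2_Xn.
Variable F : numFieldType.

Local Notation q n := (@exp_NtD2 F 'X^n).

Lemma exp_NtD2_Xn (n N : nat) : (n < N)%N ->
  q n = \sum_(k < N)
    ((-1) ^+ k / k`!%:R * (n ^_ k * n.-1 ^_ k)%:R) *: 'X^(n - k).
Proof.
move=> nN; rewrite (@exp_NtD2_widen _ _ N) ?size_polyXn//.
by apply: eq_bigr => k _; rewrite iter_tD2_Xn scalerA.
Qed.

Lemma exp_NtD2_1 : q 0 = 1.
Proof.
by rewrite (@exp_NtD2_Xn _ 1)// big_ord1 !ffactn0 mulr1 invr1 mulr1 scale1r.
Qed.

(** Only [k = n.+1] could give degree 0, and its coefficient has the factor [n ^_ n.+1], which is
    0. *)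
Lemma exp_NtD2_XnS_coef0 (n : nat) : (q n.+1)`_0 = 0.
Proof.
rewrite (@exp_NtD2_Xn _ n.+2)// coef_sum big1// => k _.
rewrite coefZ coefXn; have [kn|nk] := leqP k n.
  by rewrite subSn// mulr0.
by rewrite (@ffact_small n.+1.-1)// muln0 mulr0 mul0r.
Qed.

(* With [x] marking the degree, [\sum_n q n * x ^+ n / n`!] is
   [exp (t * x / (1 + x))]. *)
Lemma deriv_exp_NtD2_XnS (n : nat) :
  (q n.+1)^`() = n.+1%:R *: (q n - (q n)^`()).
Proof.
(* At [n = 0] the predecessor in [n.-1 ^_ k] truncates, so this case is computed directly. *)
case: n => [|n].
  rewrite exp_NtD2_1 deriv1 subr0 scale1r.
  rewrite (@exp_NtD2_Xn _ 2)// big_ord_recl big_ord1 /= ffact0n muln0 mulr0.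
  by rewrite scale0r addr0 !ffactn0 expr0 divr1 mulr1 scale1r derivX.
(* Term [k] of the derivative of [q n.+1] has the same degree as the terms [k.+1] of [q n.+1] and of
   the derivative of [q n.+2]. Hence it is expanded with one term fewer, and the other two sums lose
   their heads. *)
rewrite scalerBr {2}(@exp_NtD2_Xn n.+1 n.+2)//.
rewrite (@exp_NtD2_Xn n.+2 n.+3)// (@exp_NtD2_Xn n.+1 n.+3)//.
rewrite ![(\sum_(k < _) _)^`()]raddf_sum !scaler_sumr/=.
rewrite big_ord_recl [X in _ = X - _]big_ord_recl -addrA -sumrB.
congr (_ + _).
  rewrite !ffactn0 expr0 divr1 mulr1 scale1r !subn0 scale1r derivXn.
  by rewrite scaler_nat.
apply: eq_bigr => k _.
rewrite !lift0 !derivZ !derivXn !subSS -scaler_nat !scalerA.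
have -> : (n.+1 - k).-1 = (n - k)%N by lia.
rewrite -scalerBl; congr (_ *: _).
rewrite (ffactSS n.+1) {1}(ffactSS n) !(ffactnSr _ k) factS exprS !natrM.
have k0 : k`!%:R != 0 :> F by rewrite pnatr_eq0 -lt0n fact_gt0.
have k1 : k.+1%:R != 0 :> F by rewrite pnatr_eq0.
have [kn|nk] := leqP k n; last first.
  by rewrite (_ : (n.+1 - k)%N = 0%N) ?mulr0 ?mul0r ?mulr0 ?subr0//; lia.
rewrite (natrB _ kn) (natrB _ (leqW kn)).
by field; rewrite k0 nat1r k1.
Qed.

End exp_NtD2_Xn.

(** * Counting arrangements by the color of the first vertex *)

Lemma card_tuple_cons (T : finType) (n : nat) (Q : pred (seq T)) :
  #|[set p : n.+1.-tuple T | Q p]| =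
  (\sum_x #|[set p : n.-tuple T | Q (x :: p)]|)%N.
Proof.
under eq_bigr do rewrite -sum1dep_card.
rewrite -sum1dep_card pair_big_dep/=.
rewrite (reindex (fun u : T * n.-tuple T => cons_tuple u.1 u.2))//=.
exists (fun p : n.+1.-tuple T => (thead p, behead_tuple p)) => [[x p]|p] _ /=.
  by congr (_, _); apply: val_inj.
by rewrite [RHS]tuple_eta; apply: val_inj.
Qed.

Lemma perm_enum_cons (T : finType) (A : {set T}) (x : T) (p : seq T) :
  perm_eq (x :: p) (enum A) = (x \in A) && perm_eq p (enum (A :\ x)).
Proof.
have [xA|xA] /= := boolP (x \in A); last first.
  apply: contraNF xA => /perm_mem/(_ x).
  by rewrite mem_head mem_enum => <-.
rewrite -(perm_cons x p); apply: permPr.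
apply: uniq_perm; rewrite ?enum_uniq//= ?enum_uniq ?mem_enum ?setD11//.
move=> y; rewrite inE !mem_enum in_setD1.
by have [->|] := eqVneq y x.
Qed.

Section colored_arrangements.
Variables (V I : finType) (c : V -> I).

Local Notation bichrom := [rel u v | c u != c v].

(** The length [n] is a separate index for the induction; there are no arrangements unless it equals
    [#|A|]. *)
Definition arrangements (n : nat) (A : {set V}) : {set n.-tuple V} :=
  [set p : n.-tuple V | perm_eq p (enum A) && sorted bichrom p].

(** With [ohead], the empty arrangement begins with no color, in accordance with q_0' = 0. *)
Definition arrangements_from (i : I) (n : nat) (A : {set V}) :
    {set n.-tuple V} :=
  [set p in arrangements n A | ohead (map c p) == Some i].

Definition color_card (A : {set V}) (i : I) : nat :=
  #|[set v in A | c v == i]|.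

(** The tail after [v] is any arrangement of [A :\ v] not beginning with [i]. The subtraction is not
    truncated, since those beginning with [i] form a subset. *)
Lemma arrangements_fromS (i : I) (n : nat) (A : {set V}) :
  #|arrangements_from i n.+1 A| =
  (\sum_(v in A | c v == i)
     (#|arrangements n (A :\ v)| - #|arrangements_from i n (A :\ v)|))%N.
Proof.
pose Q (p : seq V) := [&& perm_eq p (enum A), sorted bichrom p
  & ohead (map c p) == Some i].
have -> : arrangements_from i n.+1 A = [set p : n.+1.-tuple V | Q p].
  by apply/finset.setP => p; rewrite !inE /Q -andbA.
rewrite card_tuple_cons [RHS]big_mkcond/=; apply: eq_bigr => v _.
rewrite /Q /=; case: ifPn => [/andP[vA /eqP ci]|vAi]; last first.
  apply/eqP; rewrite cards_eq0; apply/eqP/finset.setP => p; rewrite !inE.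
  apply: contraNF vAi; rewrite perm_enum_cons => /and3P[/andP[-> _] _].
  by move=> /eqP[->]; rewrite eqxx.
have sub : arrangements_from i n (A :\ v) \subset arrangements n (A :\ v).
  by apply/fintype.subsetP => p; rewrite inE => /andP[].
rewrite -cardsDS//; apply: eq_card => p; rewrite !inE perm_enum_cons vA ci eqxx.
rewrite andbT /=; case: perm_eq => //=; case: p => -[|x p] //= _.
rewrite ci [_ == Some i](_ : _ = (c x == i)) // (eq_sym i).
by case: (c x == i); case: path.
Qed.

Lemma arrangementsS (n : nat) (A : {set V}) :
  #|arrangements n.+1 A| = (\sum_i #|arrangements_from i n.+1 A|)%N.
Proof.
rewrite -sum1_card.
rewrite (partition_big (fun p : n.+1.-tuple V => c (thead p)) predT)//=.
apply: eq_bigr => i _; rewrite -sum1_card; apply: eq_bigl => p.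
by rewrite [in RHS]inE; case/tupleP: p => x p /=; rewrite theadE.
Qed.

Lemma color_cardD1 (A : {set V}) (v : V) (i : I) : v \in A ->
  color_card A i = ((c v == i) + color_card (A :\ v) i)%N.
Proof.
move=> vA; rewrite /color_card (cardsD1 v) !inE vA/=; congr (_ + _)%N.
by apply: eq_card => u; rewrite !inE andbA.
Qed.

Variable F : numFieldType.

Local Notation q n := (@exp_NtD2 F 'X^n).

(** Both counts go through one induction: the count by first color uses both smaller counts, and the
    total is its sum over the colors. *)
Lemma card_arrangements_fact_moment (n : nat) (A : {set V}) : #|A| = n ->
  #|arrangements n A|%:R = fact_moment (\prod_i q (color_card A i)) /\
  forall i, #|arrangements_from i n A|%:R = fact_moment
    ((q (color_card A i))^`() * \prod_(j | j != i) q (color_card A j)).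
Proof.
elim: n A => [|n IH] A An.
  have -> : A = finset.set0 by apply/eqP; rewrite -cards_eq0 An.
  have c0 i : color_card finset.set0 i = 0%N.
    by apply/eqP; rewrite cards_eq0; apply/eqP/finset.setP => v; rewrite !inE.
  split=> [|i].
    rewrite big1 ?fact_moment1 => [|i _]; last by rewrite c0 exp_NtD2_1.
    rewrite (_ : arrangements _ _ = [set [tuple]]) ?cards1//.
    by apply/finset.setP => p; rewrite !inE tuple0 enum_set0 perm_refl eqxx.
  rewrite c0 exp_NtD2_1 deriv1 mul0r raddf0.
  rewrite (_ : arrangements_from _ _ _ = finset.set0) ?cards0//.
  by apply/finset.setP => p; rewrite !inE tuple0/= andbF.
have from i : #|arrangements_from i n.+1 A|%:R = fact_moment
    ((q (color_card A i))^`() * \prod_(j | j != i) q (color_card A j)).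
  rewrite arrangements_fromS natr_sum.
  case k : (color_card A i) => [|k'].
    rewrite big_pred0 => [|v]; last first.
      apply/negbTE/negP => vA.
      move/eqP: k; rewrite cards_eq0 => /eqP/finset.setP/(_ v).
      by rewrite !inE vA.
    by rewrite exp_NtD2_1 deriv1 mul0r raddf0.
  (* By induction the summand depends only on the color of [v], and [k'.+1] vertices have color
     [i]. *)
  rewrite (eq_bigr (fun=> fact_moment ((q k' - (q k')^`()) *
      \prod_(j | j != i) q (color_card A j)))) => [|v /andP[vA /eqP cv]].
    rewrite sumr_const (_ : #|_| = k'.+1) -?raddfMn//=; last first.
      by rewrite -k; apply: eq_card => v; rewrite !inE.
    by rewrite deriv_exp_NtD2_XnS scaler_nat mulrnAl.
  have An' : #|A :\ v| = n by move: An; rewrite (cardsD1 v) vA => -[].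
  have [N S] := IH _ An'.
  rewrite natrB; last first.
    by apply/subset_leq_card/fintype.subsetP => p; rewrite inE => /andP[].
  rewrite N S -raddfB/= (bigD1 i)//= -mulrBl.
  have := k; rewrite (color_cardD1 i vA) cv eqxx /= add1n => -[->].
  congr (fact_moment (_ * _)); apply: eq_bigr => j ji.
  by rewrite (color_cardD1 j vA) cv eq_sym (negbTE ji).
split=> //; rewrite arrangementsS natr_sum fact_moment_deriv deriv_prod.
rewrite raddf_sum/= (eq_bigr _ (fun i _ => from i)).
(* A vertex [v] exists, so the factor for its color has positive index and constant term 0. *)
have /card_gt0P[v vA] : (0 < #|A|)%N by rewrite An.
suff -> : (\prod_i q (color_card A i))`_0 = 0 by rewrite add0r.
rewrite (bigD1 (c v))//= (color_cardD1 _ vA) eqxx/= add1n.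
by rewrite coef0M exp_NtD2_XnS_coef0 mul0r.
Qed.

End colored_arrangements.

(** Coloring each vertex by its part, [tag], turns Hamiltonian paths into arrangements of the whole
    vertex set. *)
Lemma num_hamiltonian_paths_multipartite (F : numFieldType) (m : nat)
    (alpha : 'I_m -> nat) :
  (num_hamiltonian_paths (@complete_multipartite m alpha))%:R =
  fact_moment (\prod_i @exp_NtD2 F 'X^(alpha i)).
Proof.
pose V := multipartite_vertex alpha.
have [+ _] := @card_arrangements_fact_moment V _ (@tag _ _) F _ _ (cardsT V).
have cE i : color_card (@tag _ _) [set: V] i = alpha i.
  rewrite /color_card -[RHS]card_ord -cardsT.
  pose f (u : 'I_(alpha i)) : V := Tagged _ u.
  have f_inj : injective f by exact: eq_from_Tagged.
  rewrite -(card_imset _ f_inj); congr #|pred_of_set _|.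
  apply/finset.setP => v; rewrite !inE/=; apply/eqP/imsetP => [vi|[u _ ->]//].
  by exists (etagged vi); rewrite // /f etaggedK.
under eq_bigr do rewrite cE.
move=> <-; congr (_%:R); apply: eq_card => p; rewrite !inE [RHS]andbC.
congr (_ && _); apply/forallP/idP => [p1|/seq.permP p1 v].
  apply/allP => v _ /=.
  by rewrite (eqP (p1 v)) count_uniq_mem ?enum_uniq// mem_enum inE.
by rewrite p1 count_uniq_mem ?enum_uniq// mem_enum inE.
Qed.

(** * Factorials as integrals against [expR (- x)] *)

Section exponential_moments.
Import numFieldNormedType.Exports.
Local Open Scope classical_set_scope.

(** For x > 0, e^x exceeds x^(k+1)/(k+1)!, so the expression is at most (k+1)!/x. *)
Lemma cvgr_XnexpRN (R : realType) (k : nat) :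
  x ^+ k * expR (- x) @[x --> +oo] --> (0 : R).
Proof.
apply/cvgrPdist_le => e e0; near=> x.
have x0 : 0 < x by near: x; apply: nbhs_pinfty_gt; exact: num_real.
rewrite sub0r normrN ger0_norm; last first.
  by rewrite mulr_ge0 ?expR_ge0 ?exprn_ge0 ?ltW.
rewrite expRN ler_pdivrMr ?expR_gt0//.
have fe : k.+1`!%:R / e <= x by near: x; apply: nbhs_pinfty_ge; exact: num_real.
apply: le_trans (_ : e * (x ^+ k.+1 / k.+1`!%:R) <= _); last first.
  rewrite ler_pM2l// (le_trans _ (expR_ge1Dxn k (ltW x0)))//.
  by rewrite lerDr.
rewrite mulrA ler_pdivlMr ?ltr0n ?fact_gt0// exprS mulrA mulrC.
rewrite ler_pM2r ?exprn_gt0// mulrC.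
by rewrite -ler_pdivrMr// mulrC.
Unshelve. all: by end_near. Qed.

Lemma cvgr_polyexpRN (R : realType) (p : {poly R}) :
  p.[x] * expR (- x) @[x --> +oo] --> (0 : R).
Proof.
(* The extra power absorbs the factor ['X] in the induction on [p]. *)
suff H k : p.[x] * (x ^+ k * expR (- x)) @[x --> +oo] --> (0 : R).
  by have := H 0%N; under eq_fun do rewrite expr0 mul1r.
elim/poly_ind: p k => [|p c IH] k.
  by under eq_fun do rewrite horner0 mul0r; exact: cvg_cst.
have -> : (fun x => (p * 'X + c%:P).[x] * (x ^+ k * expR (- x))) =
    (fun x => p.[x] * (x ^+ k.+1 * expR (- x)) + c * (x ^+ k * expR (- x))).
  by apply/funext => x; rewrite hornerMXaddC exprS; ring.
rewrite -(addr0 0) -{2}(mulr0 c); apply: cvgD; first exact: IH.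
by apply: cvgMr; exact: cvgr_XnexpRN.
Qed.

Lemma is_derive_polyexpRN (R : realType) (p : {poly R}) (x : R) :
  is_derive x 1 (fun y => - (p.[y] * expR (- y)))
    ((p - p^`()).[x] * expR (- x)).
Proof.
by apply: is_derive_eq; rewrite !hornerE /= /GRing.scale/=; ring.
Qed.

(** Such a [p] makes -p(x) e^(-x) an antiderivative of x^n e^(-x), and p(0) is then the integral
    over the half-line. *)
Lemma poly_subderiv_Xn (R : nzRingType) (n : nat) :
  exists p : {poly R}, p - p^`() = 'X^n /\ p.[0] = n`!%:R.
Proof.
elim: n => [|n [p [pE p0]]].
  by exists 1; rewrite deriv1 subr0 hornerC.
(* The derivative (n+1) x^n of the new power cancels (n+1)(p - p'). *)
exists ((p *+ n.+1 + 'X^(n.+1))%R : {poly R}); split.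
  by rewrite derivD derivXn derivMn -pE -mulrnDl subrKC addrAC subrr add0r.
by rewrite hornerD hornerXn expr0n addr0 hornerMn p0 factS natrM mulr_natl.
Qed.

Lemma integral_XnexpRN (R : realType) (n : nat) :
  (\int[lebesgue_measure]_(x in `[0%R, +oo[) (x ^+ n * expR (- x))%:E
   = (n`!%:R : R)%:E)%E.
Proof.
have [p [pE p0]] := poly_subderiv_Xn R n.
pose F y := - (p.[y] * expR (- y)).
have dF (x : R) : is_derive x 1 F ((p - p^`()).[x] * expR (- x)).
  exact: is_derive_polyexpRN.
have F_cont (x : R) : {for x, continuous F}.
  by apply: differentiable_continuous; apply/derivable1_diffP.
rewrite (@ge0_continuous_FTC2y _ _ F _ 0)//.
- by rewrite /F oppr0 expR0 mulr1 p0 EFinN oppeK add0e.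
- by move=> x x0; rewrite mulr_ge0 ?expR_ge0 ?exprn_ge0.
- apply: continuous_subspaceT => x.
  apply: (@continuousM _ R^o (fun x => x ^+ n) (fun x => expR (- x))).
    exact: exprn_continuous.
  by apply: continuous_comp; [exact: opp_continuous|exact: continuous_expR].
- by rewrite -oppr0; apply: cvgN; exact: cvgr_polyexpRN.
- exact/cvg_at_right_filter/F_cont.
- by move=> x _; rewrite derive1E derive_val pE hornerXn.
Qed.

(** * Integration against a measure given by a density *)

Section density.
Local Open Scope ereal_scope.
Context d (T : measurableType d) (R : realType).
Variables (nu : {finite_measure set T -> \bar R})
  (mu : {sigma_finite_measure set T -> \bar R}) (g : T -> \bar R).
Hypotheses (g0 : forall x, 0 <= g x) (mg : measurable_fun [set: T] g).
Hypothesis nug : forall A, measurable A -> nu A = \int[mu]_(x in A) g x.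

Lemma density_dominates : nu `<< mu.
Proof.
apply/null_content_dominatesP => A mA A0; rewrite nug//.
by apply: null_set_integral => //; exact: measurable_funTS.
Qed.

(** The density [g] agrees almost everywhere with the Radon-Nikodym derivative, as both have the
    same integral over every measurable set. *)
Lemma ge0_integral_density (f : T -> \bar R) :
  (forall x, 0 <= f x) -> measurable_fun [set: _] f ->
  \int[nu]_x f x = \int[mu]_x (f x * g x).
Proof.
move=> f0 mf; have dom := density_dominates.
have gi : mu.-integrable setT g.
  apply/integrableP; split => //.
  under eq_integral do rewrite gee0_abs//.
  by rewrite -nug// -ge0_fin_numE// fin_num_measure.
have mh := measurable_int _ (Radon_Nikodym_SigmaFinite.f_integrable dom).
rewrite -(Radon_Nikodym_SigmaFinite.change_of_variables dom)//.
apply: ae_eq_integral => //.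
- exact: emeasurable_funM.
- exact: emeasurable_funM.
apply/ae_eqe_mul2l/ae_eq_sym/integral_ae_eq => // E _ mE.
by rewrite -nug// (Radon_Nikodym_SigmaFinite.f_integral dom).
Qed.

End density.

(** * Expectations of polynomials in an Exp(1) variable *)

Section exponential_expectation.
Context (R : realType) (d : measure_display) (T : measurableType d)
  (P : probability T R) (X : {RV P >-> R}).
Hypothesis X_Exp1 : forall A : set R, measurable A ->
  distribution P X A = exponential_prob 1 A.

Lemma ge0_expectation_exponential (f : R -> R) :
  (forall x, 0 <= f x) -> measurable_fun [set: _] f ->
  (\int[P]_w (f (X w))%:E =
  \int[lebesgue_measure]_(x in `[0%R, +oo[) (f x * expR (- x))%:E)%E.
Proof.
move=> f0 mf.
(* [R] and [measurableTypeR R] carry the same measurable sets under different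
   displays; [lebesgue_measure] lives on the latter. *)
have mX : @measurable_fun _ _ T (measurableTypeR R) setT X.
  exact: (measurable_funP X).
pose Y : {mfun T >-> measurableTypeR R} := HB.pack (X : T -> measurableTypeR R)
  (isMeasurableFun.Build _ _ T (measurableTypeR R) _ mX).
have mf' : @measurable_fun _ _ (measurableTypeR R) (\bar R) setT (EFin \o f).
  exact/measurable_EFinP.
have mpdf : @measurable_fun _ _ (measurableTypeR R) (\bar R) setT
    (EFin \o exponential_pdf 1).
  by apply/measurable_EFinP; exact: measurable_exponential_pdf.
have f0' x : (0 <= (EFin \o f) x)%E by rewrite lee_fin.
rewrite -[LHS](ge0_integral_distribution Y mf' f0').
rewrite (@ge0_integral_density _ _ _ (distribution P Y) lebesgue_measure
  (fun x => (exponential_pdf 1 x)%:E))//.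
- rewrite [RHS]integral_mkcond; apply: eq_integral => x _.
  rewrite /exponential_pdf /= !patchE; case: ifP => _; last by rewrite mule0.
  by rewrite mul1r mulN1r.
- by move=> x; rewrite lee_fin exponential_pdf_ge0.
Qed.

Lemma integrable_exponential_Xn (n : nat) :
  P.-integrable setT (fun w => (X w ^+ n)%:E).
Proof.
apply/integrableP; split.
  by apply/measurable_EFinP; exact: measurable_funX.
under eq_integral do rewrite abse_EFin.
rewrite (@ge0_expectation_exponential (fun x : R => `|x ^+ n|))//; last first.
  by apply: measurableT_comp => //; exact: measurable_funX.
rewrite (eq_integral
    (fun x : measurableTypeR R => ((x : R) ^+ n * expR (- x))%:E)).
  by rewrite integral_XnexpRN ltry.
by move=> x; rewrite inE/= in_itv/= andbT => x0; rewrite ger0_norm ?exprn_ge0.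
Qed.

(** [X] may be negative on a null set, so positive and negative parts are integrated separately; the
    negative part contributes 0 because x^n is nonnegative on the half-line. *)
Lemma expectation_exponential_Xn (n : nat) :
  (\int[P]_w (X w ^+ n)%:E = n`!%:R%:E)%E.
Proof.
pose f (x : R) := x ^+ n.
have mf : measurable_fun setT f by exact: measurable_funX.
have fE : (fun w => (X w ^+ n)%:E) = EFin \o (f \o X) by [].
rewrite integralE fE funerpos funerneg.
rewrite (@ge0_expectation_exponential f^\+).
1: rewrite (@ge0_expectation_exponential f^\-).
- rewrite (eq_integral
    (fun x : measurableTypeR R => ((x : R) ^+ n * expR (- x))%:E)).
    rewrite integral_XnexpRN integral0_eq ?sube0// => x /=.
    rewrite in_itv/= andbT => x0.
    by rewrite /funrneg max_r ?mul0r// oppr_le0 exprn_ge0.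
  move=> x; rewrite inE/= in_itv/= andbT => x0.
  by rewrite /funrpos max_l// exprn_ge0.
- exact: funrneg_ge0.
- exact: measurable_funrneg.
- exact: funrpos_ge0.
- exact: measurable_funrpos.
Qed.

Lemma expectation_exponential_poly (p : {poly R}) :
  (\int[P]_w (p.[X w])%:E = (fact_moment p)%:E)%E.
Proof.
under eq_integral do rewrite horner_coef -sumEFin.
rewrite integral_sum//=; last first.
  move=> i; under eq_fun do rewrite EFinM.
  by apply: integrableZl => //; exact: integrable_exponential_Xn.
rewrite -sumEFin; apply: eq_bigr => i _.
under eq_integral do rewrite EFinM.
rewrite integralZl//; last exact: integrable_exponential_Xn.
by rewrite expectation_exponential_Xn.
Qed.

End exponential_expectation.

End exponential_moments.

Theorem theorem6p3 (R : realType) (d : measure_display) (T : measurableType d)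
    (P : probability T R) (X : {RV P >-> R})
    (X_Exp1 : forall A : set R, measurable A ->
       distribution P X A = exponential_prob 1 A)
    (m : nat) (m_ge1 : (1 <= m)%N)
    (alpha : 'I_m -> nat) (alpha_ge1 : forall i, (1 <= alpha i)%N) :
  (num_hamiltonian_paths (@complete_multipartite m alpha))%:R%:E =
  'E_P[(fun w => \prod_(i < m)
          ((-1) ^+ alpha i * (alpha i)`!%:R
             * (laguerreN1 R (alpha i)).[X w]))%R]%E.
Proof.
rewrite (num_hamiltonian_paths_multipartite R) expectation.unlock.
rewrite -(expectation_exponential_poly X_Exp1).
apply: eq_integral => w _; rewrite horner_prod; congr (_%:E).
(* The factor (-1)^a a! cancels the normalization of [laguerreN1], leaving q_a. *)
apply: eq_bigr => i _; rewrite /laguerreN1 hornerZ mulrA mulrACA.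
by rewrite -expr2 sqrr_sign mul1r divff ?mul1r// pnatr_eq0 -lt0n fact_gt0.
Qed.
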